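(* Let $f=h+g$ where $h\in\mathcal S^1_{\mu,L}$ with $0\leqslant\mu\leqslant L<\infty$, $L>0$, and $g:V\to\mathbb R\cup\{+\infty\}$ is proper, lower semicontinuous and convex; let $x^*$ be a global minimizer of $f$. Let $x_0,v_0\in V$, $\gamma_0>0$, $s=1/L$, and for $k=0,1,\dots$ define $$\alpha_k=\frac{\gamma_k+\sqrt{\gamma_k^2+4L\gamma_k}}{2L},\qquad y_k=\frac{x_k+\alpha_kv_k}{1+\alpha_k},\qquad x_{k+1}=\mathbf{prox}_{sg}(y_k-s\nabla h(y_k)),$$ $$v_{k+1}=\frac{\gamma_kv_k+\mu\alpha_ky_k}{\gamma_k+\mu\alpha_k}+\frac{\gamma_k(1+\alpha_k)}{\gamma_k+\mu\alpha_k}\,\frac{x_{k+1}-y_k}{\alpha_k},\qquad\gamma_{k+1}=\frac{\gamma_k+\mu\alpha_k}{1+\alpha_k}.$$ Put $\mathcal L_k=f(x_k)-f(x^* )+\frac{\gamma_k}2\|v_k-x^*\|^2$. Then $$\mathcal L_{k+1}\leqslant\frac{\mathcal L_k}{1+\alpha_k}\qquad\forall\,k\in\mathbb N,$$ and this implies, when $\gamma_0=rL\geqslant\mu$, $$\mathcal L_k\leqslant\mathcal L_0\times\min\left\{\left(\frac2{2+\sqrt r\,k}\right)^2,\ \left(1+\sqrt{\frac\mu L}\right)^{-k}\right\}.$$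
   Context: $V$ is a real Hilbert space with norm $\|\cdot\|$, identified with its dual by the Riesz map (so gradients are elements of $V$); $\langle\cdot,\cdot\rangle$ is the pairing. $\mathbb N$ includes $0$. $\mathcal S^1_{\mu,L}$ is the set of convex continuously differentiable $h:V\to\mathbb R$ with $\mu\|x-y\|^2\leqslant\langle\nabla h(x)-\nabla h(y),x-y\rangle\leqslant L\|x-y\|^2$ for all $x,y\in V$. $\mathbf{prox}_{sg}(z)=\operatorname{argmin}_x\{g(x)+\frac1{2s}\|x-z\|^2\}$. Inequalities are understood in $(-\infty,+\infty]$ if $f(x_0)=+\infty$. Existence of a global minimizer is a standing assumption. *)

(* Defs.v *)
From HB Require Import structures.
From mathcomp Require Import all_boot all_order all_algebra.
From mathcomp Require Import all_classical all_reals all_analysis.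

Set Implicit Arguments.
Unset Strict Implicit.
Unset Printing Implicit Defensive.

Import Order.TTheory GRing.Theory Num.Theory.
Import numFieldNormedType.Exports.

Local Open Scope classical_set_scope.
Local Open Scope ring_scope.

(* A real Hilbert space is a complete normed module V over R : realType whose
   norm comes from an inner product.  [dot] is a symmetric positive definite
   bilinear form (theta = idfun is the real case of MathComp's sesquilinear
   forms). *)
Definition inner_product_of_norm (R : realType) (V : completeNormedModType R)
    (dot : {dot V for idfun}) : Prop :=
  forall x : V, dot x x = `|x| ^+ 2.

(* The Riesz representative of the Frechet differential 'd h x.  It exists and
   is unique wherever h is differentiable; [xget] only fills in a junk value 0
   at the other points. *)
Definition gradient (R : realType) (V : completeNormedModType R)
    (dot : {dot V for idfun}) (h : V -> R) (x : V) : V :=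
  xget 0 [set w : V | forall u : V, 'd h x u = dot w u].

Definition S1 (R : realType) (V : completeNormedModType R)
    (dot : {dot V for idfun}) (mu L : R) (h : V -> R) : Prop :=
  [/\ @convex_function R V setT h,
      (forall x : V, differentiable h x),
      continuous (gradient dot h)
    & forall x y : V,
        mu * `|x - y| ^+ 2
          <= dot (gradient dot h x - gradient dot h y) (x - y)
          <= L * `|x - y| ^+ 2].

Definition proper_fun (R : realType) (V : Type) (g : V -> \bar R) : Prop :=
  (forall x, g x != -oo%E) /\ (exists x, g x != +oo%E).

(* For t = 0 or t = 1 the convention 0 * +oo = 0 makes the inequality an
   identity, so the endpoints add no constraint. *)
Definition econvex (R : realType) (V : lmodType R) (g : V -> \bar R) : Prop :=
  forall (t : R) (x y : V), 0 <= t <= 1 ->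
    (g (t *: x + (1 - t) *: y)%R
       <= t%:E * g x + (1 - t)%:E * g y)%E.

Definition argmin (R : realType) (V : Type) (phi : V -> \bar R) : set V :=
  [set x | forall y, (phi x <= phi y)%E].

(* The minimizer exists and is unique for s > 0 and g proper, lower
   semicontinuous and convex on a Hilbert space; [xget] only fills in a junk
   value z in the other cases. *)
Definition prox (R : realType) (V : completeNormedModType R)
    (s : R) (g : V -> \bar R) (z : V) : V :=
  xget z (argmin (fun x : V => (g x + ((2 * s)^-1 * `|x - z| ^+ 2)%:E)%E)).

(* Main.v *)
(** The prox optimality condition and the two quadratic bounds on [h] give,
    with [G = L (y_k - x_{k+1})],
    [f x_{k+1} <= f z - <G, z - y_k> - |G|^2 / (2 L) - mu / 2 |z - y_k|^2]
    for every [z].  Adding the case [z = x_k] to [alpha_k] times the case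
    [z = x^*] and inserting the update of [v], everything cancels by
    [L alpha_k^2 = gamma_k (1 + alpha_k)] except the nonpositive term
    [- mu alpha_k / (2 (gamma_k + mu alpha_k) gamma_k)
       * |alpha_k G - gamma_k (v_k - y_k)|^2].
    The rates come from bounding [lambda_k = \prod_(i < k) (1 + alpha_i)^-1]:
    [gamma_k >= mu] forces [alpha_k >= sqrt (mu / L)], and
    [gamma_k >= gamma_0 lambda_k] makes [lambda_k ^ (-1/2)] grow by at least
    [sqrt r / 2] at each step.  Riesz representatives and proximal points exist
    for one and the same reason: a lower semicontinuous convex function plus a
    multiple of the squared distance to a point has a minimizer. *)

Require Import Defs.
From HB Require Import structures.
From mathcomp Require Import all_boot all_order all_algebra.
From mathcomp Require Import all_classical all_reals all_analysis.
From mathcomp Require Import ring lra.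

Set Implicit Arguments.
Unset Strict Implicit.
Unset Printing Implicit Defensive.

Import Order.TTheory GRing.Theory Num.Theory.
Import numFieldNormedType.Exports.

Local Open Scope classical_set_scope.
Local Open Scope ring_scope.

(** * Expansion rules for the inner product *)

Section Dot.
Variables (R : realType) (V : completeNormedModType R).
Variable (dot : {dot V for idfun}).

Lemma dotC u w : dot u w = dot w u.
Proof. by rewrite hermC expr0 mul1r. Qed.

Lemma dotDl u v w : dot (u + v) w = dot u w + dot v w.
Proof. exact: linearDl. Qed.

Lemma dotDr u v w : dot w (u + v) = dot w u + dot w v.
Proof. exact: linearDr. Qed.

Lemma dotNl u w : dot (- u) w = - dot u w.
Proof. exact: linearNl. Qed.

Lemma dotNr u w : dot w (- u) = - dot w u.
Proof. exact: linearNr. Qed.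

Lemma dotZl a u w : dot (a *: u) w = a * dot u w.
Proof. exact: linearZl_LR. Qed.

Lemma dotZr a u w : dot w (a *: u) = a * dot w u.
Proof. exact: linearZr_LR. Qed.

Definition dotE := (dotDl, dotDr, dotNl, dotNr, dotZl, dotZr).

End Dot.

(** This replaces letting [t] tend to 0 in first-order optimality arguments. If [a > 0], then
    [t = 1] gives [a <= b], so [t = a / (2 * b)] is admissible and yields [a <= a / 2]. *)
Lemma le0_of_small_multiples (R : realFieldType) (a b : R) :
  (forall t, 0 < t <= 1 -> a <= t * b) -> a <= 0.
Proof.
move=> H; rewrite leNgt; apply/negP => a0.
have b0 : 0 < b by have := H 1; rewrite mul1r ltr01 lexx => /(_ isT); lra.
have ab : a <= b by have := H 1; rewrite mul1r ltr01 lexx => /(_ isT).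
have := H (a / (2 * b)).
have -> : a / (2 * b) * b = a / 2 by field; apply: lt0r_neq0.
rewrite divr_gt0 ?mulr_gt0//= ler_pdivrMr ?mulr_gt0// mul1r.
have ab2 : a <= 2 * b by lra.
by move=> /(_ ab2); lra.
Qed.

(** * Existence of minimizers for quadratically perturbed convex functions *)

Section Min.
Variables (R : realType) (V : completeNormedModType R).
Variables (dot : {dot V for idfun}) (hdot : inner_product_of_norm dot).

(* A minimizing sequence is Cauchy: by the parallelogram identity, two points
   whose values are close to the infimum have a midpoint that would otherwise
   go below it. *)
Lemma argmin_quadratic_perturbation (g : V -> \bar R) (c : R) (w : V) (m : R) :
  0 < c -> proper_fun g -> lower_semicontinuous g -> econvex g ->
  (forall x, m%:E <= g x + (c * `|x - w| ^+ 2)%:E)%E ->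
  exists p, argmin (fun x => (g x + (c * `|x - w| ^+ 2)%:E)%E) p.
Proof.
move=> c0 [gN [x0 gx0]] glsc gcvx mlb.
pose q x := c * `|x - w| ^+ 2.
pose phi x := (g x + (q x)%:E)%E.
have [i iE] : exists i : R, ereal_inf (range phi) = i%:E.
  have : (m%:E <= ereal_inf (range phi))%E.
    by apply: le_ereal_inf_tmp => _ [x _ <-]; exact: mlb.
  have : (ereal_inf (range phi) <= phi x0)%E.
    by apply: ereal_inf_lbound; exists x0.
  rewrite /phi; move: gx0 (gN x0); case: (g x0) => // a _ _.
  by case: (ereal_inf _) => // b _ _; exists b.
have ilb x : (i%:E <= phi x)%E by rewrite -iE; apply: ereal_inf_lbound; exists x.
have /choice[u uP] : forall n : nat, exists x, (phi x < (i + n.+1%:R^-1)%:E)%E.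
  move=> n; have : (ereal_inf (range phi) < (i + n.+1%:R^-1)%:E)%E.
    by rewrite iE lte_fin ltrDl invr_gt0.
  by move/ereal_inf_lt => [_ [x _ <-] ?]; exists x.
(* At the midpoint [phi] is at least [i], and at most the mean of its values at [u n] and [u k]
   minus [c / 4] times the squared distance. *)
have ugap n k : c / 2 * `|u n - u k| ^+ 2 <= n.+1%:R^-1 + k.+1%:R^-1.
  have := ilb (2^-1 *: u n + (1 - 2^-1) *: u k).
  have h2 : 0 <= (2^-1 : R) <= 1 by lra.
  have := gcvx 2^-1 (u n) (u k) h2.
  rewrite /phi; move: (gN (2^-1 *: u n + (1 - 2^-1) *: u k)) (uP n) (uP k).
  rewrite /phi; move: (gN (u n)) (gN (u k)).
  case: (g (u n)) => // a _; case: (g (u k)) => // b _.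
  case: (g (_ *: _ + _ *: _)) => [d| |] _; rewrite ?(=^~EFinM, =^~EFinD) ?lte_fin ?lee_fin //.
  have -> : q (2^-1 *: u n + (1 - 2^-1) *: u k) =
      2^-1 * q (u n) + 2^-1 * q (u k) - c / 4 * `|u n - u k| ^+ 2.
    rewrite /q -!hdot !dotE (dotC dot (u k) (u n)) (dotC dot w) (dotC dot w).
    by field.
  move: (q (u n)) (q (u k)) (n.+1%:R^-1) (k.+1%:R^-1) (`|u n - u k| ^+ 2).
  by move=> *; lra.
have ucvg : cvg (u @ \oo).
  apply/cauchy_cvgP/cauchy_ballP => e e0.
  (* Two tail terms below this threshold add up to less than [c / 2 * e ^+ 2], as [ugap]
     requires. *)
  have e1 : 0 < c / 4 * e ^+ 2 by rewrite mulr_gt0 ?divr_gt0 ?exprn_gt0.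
  have := near_infty_natSinv_lt (PosNum e1).
  move=> [N _ NP].
  exists ([set u n | n in [set n | (N <= n)%N]], [set u n | n in [set n | (N <= n)%N]]).
    by split; exists N => // n Nn; exists n.
  move=> [_ _] [[n /= Nn <-] [k /= Nk <-]].
  rewrite -ball_normE /=.
  have c2 : 0 < c / 2 by rewrite divr_gt0.
  rewrite -(@ltr_pXn2r _ 2) ?nnegrE ?(ltW e0)// -(ltr_pM2l c2).
  move: (ugap n k) (NP _ Nn) (NP _ Nk) => /=.
  by move: (n.+1%:R^-1) (k.+1%:R^-1) => *; lra.
pose p := lim (u @ \oo).
exists p => x; apply: le_trans (ilb x) => {x}.
rewrite -/(phi p) leNgt; apply/negP => ip.
(* A real level below [g p] covers the case [g p = +oo] too. Semicontinuity keeps [g (u n)] above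
   [a] eventually, so [a + q (u n) < i + n.+1%:R^-1], and the limit contradicts [ia]. *)
have [a [ga ia]] : exists a : R, (a%:E < g p)%E /\ i < a + q p.
  move: ip; rewrite /phi; move: (gN p); case: (g p) => // [b|] _.
    rewrite -EFinD lte_fin => ib; exists ((b + (i - q p)) / 2).
    by rewrite lte_fin; split; lra.
  by exists (i - q p + 1); rewrite ltry; split => //; lra.
have [U Up UP] := glsc p a ga.
have unw : u n - w @[n --> \oo] --> p - w by apply: cvgB => //; exact: cvg_cst.
have qcvg : a + q (u n) - n.+1%:R^-1 @[n --> \oo] --> a + q p - 0.
  apply: cvgB; last exact: cvg_harmonic.
  apply: cvgD; first exact: cvg_cst.
  apply: cvgM; first exact: cvg_cst.
  by rewrite expr2; under eq_fun do rewrite expr2; apply: cvgM; exact: cvg_norm.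
suff : a + q p - 0 <= i by lra.
apply: (cvgr_to_le qcvg); near=> n.
have := UP (u n); have /[swap] /[apply] : U (u n) by near: n; exact: ucvg.
move: (uP n); rewrite /phi; move: (gN (u n)); case: (g (u n)) => // b _.
rewrite -EFinD !lte_fin; move: (n.+1%:R^-1) => *; lra.
Unshelve. all: by end_near. Qed.

End Min.

(** * Riesz representation, gradients and quadratic bounds *)

Section Gradient.
Variables (R : realType) (V : completeNormedModType R).
Variables (dot : {dot V for idfun}) (hdot : inner_product_of_norm dot).

(* The representative is the minimizer of [u |-> |u|^2 / 2 - l u]. *)
Lemma riesz_representation (l : {linear V -> R}) :
  continuous l -> exists w, forall u, l u = dot w u.
Proof.
move=> lc.
have [C C0 lC] : exists2 C, 0 < C & forall x, `|l x| <= C * `|x|.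
  have /linear_boundedP lb : bounded_near l (nbhs 0).
    by apply/linear_bounded_continuous.
  near (pinfty_nbhs R) => C; exists C; first by near: C; exact: nbhs_pinfty_gt.
  by near: C.
pose g x : \bar R := (- l x)%:E.
have gl : lower_semicontinuous g.
  apply/lower_semicontinuousP => a.
  rewrite (_ : [set x | _] = (fun x => - l x) @^-1` [set t | a < t]).
    apply: open_comp; last exact: open_gt.
    by move=> x _; apply: cvgN; exact: lc.
  by apply/seteqP; split => x /=; rewrite /g lte_fin.
have gp : proper_fun g by split => //; exists 0.
have gc : econvex g.
  move=> t x y _; rewrite /g -!EFinM -EFinD lee_fin linearD !linearZ/= /GRing.scale/=.
  lra.
(* Complete the square in [|x|^2 / 2 - C |x|]. *)
have gb x : ((- (C ^+ 2 / 2))%:E <= g x + (2^-1 * `|x - 0| ^+ 2)%:E)%E.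
  rewrite /g -EFinD lee_fin subr0; have := sqr_ge0 (`|x| - C).
  have := lC x; have := ler_norm (l x).
  by rewrite sqrrB; move: (`|x|) => r *; nra.
have half : 0 < 2^-1 :> R by rewrite invr_gt0.
have [w wmin] := argmin_quadratic_perturbation hdot half gp gl gc gb.
exists w => u.
(* Moving from [w] by [t] along [u] and along [- u] gives the two inequalities behind the
   equality. *)
have key (d : R) : (d = 1 \/ d = -1) -> d * (l u - dot w u) <= 0.
  move=> hd; apply: (@le0_of_small_multiples _ _ (`|u| ^+ 2 / 2)) => t /andP[t0 _].
  have := wmin (w + (d * t) *: u).
  rewrite /g -!EFinD lee_fin !subr0 -!hdot !dotE
    linearD linearZ /= /GRing.scale /= (dotC dot u w).
  move=> H; rewrite -(ler_pM2l t0); case: hd H => -> H; nra.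
by have := key 1 (or_introl erefl); have := key (-1) (or_intror erefl); lra.
Unshelve. all: by end_near. Qed.

Lemma gradientP (h : V -> R) (x u : V) :
  differentiable h x -> 'd h x u = dot (gradient dot h x) u.
Proof.
move=> hx; rewrite /gradient; case: xgetP => [w _|nex]; first exact.
have [w wP] := riesz_representation (diff_continuous hx).
by exfalso; apply: (nex w) => v; rewrite wP.
Qed.

Lemma is_derive_line (h : V -> R) (x d : V) (t : R) :
  (forall z, differentiable h z) ->
  is_derive t 1 (fun t => h (x + t *: d)) (dot (gradient dot h (x + t *: d)) d).
Proof.
move=> hd; set z := x + t *: d.
have quotE : (fun e : R => e^-1 *: (((fun r => h (x + r *: d)) \o shift t) (e *: 1) - h z))
    = (fun e : R => e^-1 *: ((h \o shift z) (e *: d) - h z)).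
  apply/funext => e /=; congr (_ *: (h _ - _)).
  have -> : e *: 1 = e :> R by rewrite /GRing.scale/= mulr1.
  by rewrite /z scalerDl addrCA.
have hz := diff_derivable (v := d) (hd z).
apply: DeriveDef.
  by rewrite /derivable quotE.
by rewrite /derive quotE -gradientP// -deriveE.
Qed.

(** Along the segment from [x] to [y], [e * h] minus the candidate quadratic has nonpositive
    derivative. The factor [e] lets one proof serve both bounds: [e = 1], [K = L] from above and
    [e = -1], [K = - mu] from below. *)
Lemma first_order_gap_le (h : V -> R) (e K : R) :
  (forall z, differentiable h z) ->
  (forall x y, e * dot (gradient dot h x - gradient dot h y) (x - y)
     <= K * `|x - y| ^+ 2) ->
  forall x y, e * (h y - h x - dot (gradient dot h x) (y - x))
     <= K / 2 * `|y - x| ^+ 2.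
Proof.
move=> hd gK x y; set d := y - x; set G := gradient dot h.
pose phi t := e * h (x + t *: d) - (e * dot (G x) d * t + K / 2 * `|d| ^+ 2 * t ^+ 2).
pose dphi t := e * dot (G (x + t *: d)) d - (e * dot (G x) d + K * `|d| ^+ 2 * t).
have phid (t : R) : is_derive t 1 phi (dphi t).
  rewrite /dphi; have := @is_derive_line h x d t hd; rewrite -/G.
  move: (dot (G (x + t *: d)) d) => D hD.
  by apply: is_derive_eq; rewrite /GRing.scale/=; field.
have : phi 1 <= phi 0.
  apply: (@ler0_derive1_le_cc _ phi 0 1); rewrite ?in_itv/= ?lexx ?ler01//.
  - move=> t; rewrite in_itv/= => /andP[t0 _]; rewrite derive1E.
    rewrite (@derive_val _ _ _ _ _ _ _ (phid t)).
    (* The two points differ by [t *: d], so the hypothesis is [t] times the desired sign condition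
       on [dphi t]. *)
    have := gK (x + t *: d) x; rewrite addrAC subrr add0r normrZ (gtr0_norm t0).
    rewrite exprMn dotZr dotDl dotNl -/G /dphi => gKt; rewrite -(ler_pM2l t0).
    move: (dot _ d) (dot _ d) (`|d| ^+ 2) gKt => A B D gKt; lra.
  - by apply: derivable_within_continuous => t _; exact: (@ex_derive _ _ _ _ _ _ _ (phid t)).
rewrite /phi scale1r scale0r addr0 {1}/d [x + (y - x)]addrC subrK; lra.
Qed.

End Gradient.

(** * The proximal gradient step *)

Section ProxGradient.
Variables (R : realType) (V : completeNormedModType R).
Variables (dot : {dot V for idfun}) (hdot : inner_product_of_norm dot).

Lemma argmin_fin (g : V -> \bar R) (q : V -> R) (p : V) :
  proper_fun g -> argmin (fun x => (g x + (q x)%:E)%E) p ->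
  g p \is a fin_num.
Proof.
move=> [gN [x0 gx0]] /(_ x0); move: (gN p) (gN x0) gx0.
by case: (g p) => //; case: (g x0).
Qed.

(** Optimality makes [2 * c *: (w - p)] a subgradient of [g] at [p]: compare [p] with
    [t *: z + (1 - t) *: p], use convexity, divide by [t] and let [t] tend to 0. *)
Lemma argmin_quadratic_subgradient (g : V -> \bar R) (c : R) (w p z : V) :
  proper_fun g -> econvex g ->
  argmin (fun x => (g x + (c * `|x - w| ^+ 2)%:E)%E) p ->
  (g p + (2 * c * dot (w - p) (z - p))%:E <= g z)%E.
Proof.
move=> gp gc pmin; have := argmin_fin gp pmin; have [gN _] := gp.
case gpE : (g p) => [a||] // _.
case gzE : (g z) (gN z) => [b||] // _; last by rewrite leey.
rewrite -EFinD lee_fin -subr_le0.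
apply: (@le0_of_small_multiples _ _ (c * `|z - p| ^+ 2)) => t /andP[t0 t1].
have t01 : 0 <= t <= 1 by rewrite (ltW t0).
have := gc t z p t01; have := pmin (t *: z + (1 - t) *: p).
rewrite gpE gzE -!EFinM -!EFinD.
case: (g (_ *: _ + _ *: _)) (gN (t *: z + (1 - t) *: p)) => [d||] // _.
rewrite -EFinD !lee_fin -!hdot !dotE (dotC dot w p) (dotC dot z p) (dotC dot z w).
move=> H1 H2; rewrite -(ler_pM2l t0).
move: H1 H2; move: (dot p p) (dot p w) (dot p z) (dot w w) (dot w z) (dot z z) => *.
lra.
Qed.

Variables (mu L : R) (hL : 0 < L) (h : V -> R) (hh : S1 dot mu L h).

Let G := gradient dot h.

Lemma S1_upper_bound x y :
  h y <= h x + dot (G x) (y - x) + L / 2 * `|y - x| ^+ 2.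
Proof.
have [_ hd _ hg] := hh.
have := @first_order_gap_le _ _ dot hdot h 1 L hd _ x y; rewrite -/G.
by move=> /(_ _)/wrap[u v|]; [rewrite mul1r; case/andP: (hg u v)|lra].
Qed.

Lemma S1_lower_bound x y :
  h x + dot (G x) (y - x) + mu / 2 * `|y - x| ^+ 2 <= h y.
Proof.
have [_ hd _ hg] := hh.
have := @first_order_gap_le _ _ dot hdot h (-1) (- mu) hd _ x y; rewrite -/G.
move=> /(_ _)/wrap[u v|]; last by lra.
by case/andP: (hg u v) => + _; lra.
Qed.

Variables (g : V -> \bar R) (g_proper : proper_fun g).
Variables (g_lsc : lower_semicontinuous g) (g_convex : econvex g).

Let f z := ((h z)%:E + g z)%E.

Lemma argmin_composite_fin x : argmin f x -> g x \is a fin_num.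
Proof.
move=> fx; apply: (argmin_fin (q := h) g_proper) => y.
by rewrite ![(g _ + _)%E]addeC; exact: fx.
Qed.

(** The junk value of [prox] is excluded because the objective is bounded below. Up to a constant,
    its quadratic term is the upper model of [h] at [y], so the objective dominates [f] plus a
    constant, and [f] is at least [f xs]. *)
Lemma prox_gradient_argmin (xs y : V) : argmin f xs ->
  argmin (fun x => (g x + (L / 2 * `|x - (y - L^-1 *: G y)| ^+ 2)%:E)%E)
    (prox L^-1 g (y - L^-1 *: G y)).
Proof.
move=> fmin; set w := y - _.
have L2 : (2 * L^-1)^-1 = L / 2 by rewrite invfM invrK mulrC.
rewrite /prox L2; case: xgetP => // nex; exfalso.
have L20 : 0 < L / 2 by rewrite divr_gt0.
have := argmin_composite_fin fmin; case gxs : (g xs) => [b||] // _.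
have [] := @argmin_quadratic_perturbation _ _ dot hdot g (L / 2) w
  (h xs + b - h y + L^-1 / 2 * `|G y| ^+ 2) L20 g_proper g_lsc g_convex; last first.
  by move=> p pmin; exact: (nex p).
move=> x; have := fmin x; rewrite /f gxs.
have [gN _] := g_proper; case: (g x) (gN x) => [a||] // _;
  last by move=> _; rewrite addye // leey.
rewrite -!EFinD !lee_fin.
have -> : L / 2 * `|x - w| ^+ 2 =
    L / 2 * `|x - y| ^+ 2 + dot (G y) (x - y) + L^-1 / 2 * `|G y| ^+ 2.
  rewrite /w -!hdot !dotE (dotC dot x y) (dotC dot x (G y)) (dotC dot y (G y)).
  by field; apply: lt0r_neq0.
by have := S1_upper_bound y x; lra.
Qed.

Lemma prox_gradient_inequality (xs y z : V) : argmin f xs ->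
  let p := prox L^-1 g (y - L^-1 *: G y) in
  f p \is a fin_num /\
  (f p + (L * dot (y - p) (z - y) + L / 2 * `|y - p| ^+ 2
          + mu / 2 * `|z - y| ^+ 2)%:E <= f z)%E.
Proof.
move=> fmin p; have pmin : argmin _ p := prox_gradient_argmin y fmin.
have := argmin_fin g_proper pmin; rewrite /f.
have := argmin_quadratic_subgradient z g_proper g_convex pmin.
have [gN _] := g_proper.
case: (g p) => [a||] // sub _; split => //.
move: sub; case: (g z) (gN z) => [b||] // _; last by move=> _; rewrite addeC leey.
rewrite -!EFinD !lee_fin.
(* Splitting off [G y] leaves the linear terms of the upper bound at [p] and the lower bound at [z],
   both taken from [y], so the three inequalities add up. *)
have -> : 2 * (L / 2) * dot (y - L^-1 *: G y - p) (z - p) =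
    L * dot (y - p) (z - y) + L * `|y - p| ^+ 2
    - (dot (G y) (z - y) - dot (G y) (p - y)).
  rewrite -!hdot !dotE (dotC dot p y).
  by field; apply: lt0r_neq0.
have := S1_upper_bound y p; have := S1_lower_bound y z; rewrite (distrC p y).
lra.
Qed.

End ProxGradient.

(** * One-step decay of the Lyapunov function *)

Lemma accelerated_step_le (R : realType) (V : completeNormedModType R)
    (dot : {dot V for idfun}) (mu L a c : R) (x v y p v' z : V) (fx fp fz : R) :
  inner_product_of_norm dot ->
  0 <= mu -> 0 < L -> 0 < a -> 0 < c -> L * a ^+ 2 = c * (1 + a) ->
  y = (1 + a)^-1 *: (x + a *: v) ->
  v' = (c + mu * a)^-1 *: (c *: v + (mu * a) *: y)
       + (c * (1 + a) / (c + mu * a)) *: (a^-1 *: (p - y)) ->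
  fp + (L * dot (y - p) (x - y) + L / 2 * `|y - p| ^+ 2
        + mu / 2 * `|x - y| ^+ 2) <= fx ->
  fp + (L * dot (y - p) (z - y) + L / 2 * `|y - p| ^+ 2
        + mu / 2 * `|z - y| ^+ 2) <= fz ->
  fp - fz + (c + mu * a) / (1 + a) / 2 * `|v' - z| ^+ 2
    <= (fx - fz + c / 2 * `|v - z| ^+ 2) * (1 + a)^-1.
Proof.
move=> hdot mu0 L0 a0 c0 Lac yE v'E ineqx ineqz.
have a10 : 0 < 1 + a by lra.
have tau0 : 0 < c + mu * a by rewrite ltr_wpDr// mulr_ge0// ltW.
(* Eliminating [x] and [L] turns [key] into a rational identity in the inner products of [y], [p],
   [v] and [z]. *)
have xE : x = (1 + a) *: y - a *: v.
  by rewrite yE scalerA divff ?gt_eqF// scale1r addrK.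
have LE : L = c * (1 + a) / a ^+ 2.
  by rewrite -Lac mulfK// expf_neq0// gt_eqF.
have gap0 : 0 <= mu * a / (2 * (c + mu * a) * c)
    * `|(a * L) *: (y - p) - c *: (v - y)| ^+ 2.
  by rewrite mulr_ge0 ?sqr_ge0// divr_ge0 ?mulr_ge0// ltW.
have key : (c + mu * a) / 2 * `|v' - z| ^+ 2 = c / 2 * `|v - z| ^+ 2
    + (L * dot (y - p) (x - y) + a * (L * dot (y - p) (z - y))
    + (1 + a) * (L / 2 * `|y - p| ^+ 2) + a * (mu / 2 * `|z - y| ^+ 2))
    - mu * a / (2 * (c + mu * a) * c)
       * `|(a * L) *: (y - p) - c *: (v - y)| ^+ 2.
  rewrite v'E xE LE -!hdot !dotE.
  rewrite (dotC dot p y) (dotC dot v y) (dotC dot z y) (dotC dot v p).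
  rewrite (dotC dot z p) (dotC dot z v).
  move: (dot y y) (dot y p) (dot y v) (dot y z) (dot p p) (dot p v) (dot p z).
  move: (dot v v) (dot v z) (dot z z) => *.
  field.
  by rewrite !gt_eqF.
(* This term of [ineqx] does not enter [key]; only its sign is used. *)
have mux : 0 <= mu / 2 * `|x - y| ^+ 2 by rewrite mulr_ge0 ?sqr_ge0 ?divr_ge0.
rewrite ler_pdivlMr// mulrDl.
have -> : (c + mu * a) / (1 + a) / 2 * `|v' - z| ^+ 2 * (1 + a) =
   (c + mu * a) / 2 * `|v' - z| ^+ 2 by field; rewrite gt_eqF.
rewrite key; move: ineqx (ler_wpM2l (ltW a0) ineqz) gap0 mux.
move: (_ / _ * _) (`|x - y| ^+ 2) (`|y - p| ^+ 2) (`|z - y| ^+ 2).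
move: (dot _ _) (dot _ _) (`|v - z| ^+ 2) => *; lra.
Qed.

(** * Decay rates of the product of contraction factors *)

Section Rate.
Variables (R : realType) (mu L : R) (alpha gamma : nat -> R).
Hypotheses (hmu : 0 <= mu) (hL : 0 < L) (gamma0_gt0 : 0 < gamma 0%N).
Hypothesis alpha_def : forall k, alpha k =
  (gamma k + Num.sqrt (gamma k ^+ 2 + 4 * L * gamma k)) / (2 * L).
Hypothesis gamma_rec : forall k,
  gamma k.+1 = (gamma k + mu * alpha k) / (1 + alpha k).

Let lambda k := \prod_(i < k) (1 + alpha i)^-1.

Lemma alpha_gamma_gt0 k : 0 < alpha k /\ 0 < gamma k.
Proof.
have step j : 0 < gamma j -> 0 < alpha j.
  by move=> g0; rewrite alpha_def divr_gt0 ?mulr_gt0// ltr_pwDl ?sqrtr_ge0.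
elim: k => [|k [a0 g0]]; first by split => //; exact: step.
suff g1 : 0 < gamma k.+1 by split => //; exact: step.
by rewrite gamma_rec divr_gt0// ?ltr_pwDl// ?mulr_ge0// ltW.
Qed.

Lemma alpha_gt0 k : 0 < alpha k. Proof. by have [] := alpha_gamma_gt0 k. Qed.

Lemma gamma_gt0 k : 0 < gamma k. Proof. by have [] := alpha_gamma_gt0 k. Qed.

(** [alpha k] is the positive root of this quadratic equation. *)
Lemma alpha_sqr k : L * alpha k ^+ 2 = gamma k * (1 + alpha k).
Proof.
have g0 := gamma_gt0 k.
have : 0 <= gamma k ^+ 2 + 4 * L * gamma k.
  by rewrite addr_ge0 ?sqr_ge0// !mulr_ge0// ltW.
move=> /sqr_sqrtr; rewrite alpha_def; move: (Num.sqrt _) => q qE.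
have -> : L * ((gamma k + q) / (2 * L)) ^+ 2 =
    (gamma k ^+ 2 + 2 * gamma k * q + q ^+ 2) / (4 * L).
  by field; rewrite gt_eqF.
by rewrite qE; field; rewrite gt_eqF.
Qed.

(** [gamma k.+1] is a weighted mean of [gamma k] and [mu]. *)
Lemma gamma_ge k : mu <= gamma 0%N -> mu <= gamma k.
Proof.
move=> g0; elim: k => // k IH; have a0 := alpha_gt0 k.
by rewrite gamma_rec ler_pdivlMr; lra.
Qed.

Lemma lambda_gt0 k : 0 < lambda k.
Proof. by apply: prodr_gt0 => i _; rewrite invr_gt0 addr_gt0// alpha_gt0. Qed.

Lemma lambdaS k : lambda k.+1 = lambda k / (1 + alpha k).
Proof. by rewrite /lambda big_ord_recr. Qed.

(** Dropping [mu * alpha k] from the recursion leaves the one for [lambda]. *)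
Lemma lambda_le_gamma k : gamma 0%N * lambda k <= gamma k.
Proof.
elim: k => [|k IH]; first by rewrite /lambda big_ord0 mulr1.
have a0 := alpha_gt0 k.
rewrite lambdaS mulrA gamma_rec ler_pM2r ?invr_gt0 ?addr_gt0//.
by rewrite (le_trans IH)// lerDl mulr_ge0// ltW.
Qed.

Lemma lambda_le_exp k : mu <= gamma 0%N -> lambda k <= (1 + Num.sqrt (mu / L)) ^- k.
Proof.
move=> g0; elim: k => [|k IH]; first by rewrite /lambda big_ord0 expr0 invr1.
have a0 := alpha_gt0 k.
have muL0 : 0 <= mu / L by rewrite divr_ge0// ltW.
have q0 := sqrtr_ge0 (mu / L).
rewrite lambdaS exprSr invfM ler_pM ?(ltW (lambda_gt0 k)) ?invr_ge0 ?addr_ge0 ?(ltW a0)//.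
rewrite lef_pV2 ?posrE ?(ltr_wpDr q0) ?addr_gt0//.
(* What remains is [mu <= L * alpha k ^+ 2], which follows from
   [mu <= gamma k <= gamma k * (1 + alpha k)]. *)
rewrite lerD2l -(@ler_pXn2r _ 2) ?nnegrE ?(ltW a0)// sqr_sqrtr//.
rewrite ler_pdivrMr// mulrC alpha_sqr.
have := gamma_ge k g0; have := gamma_gt0 k; nra.
Qed.

Lemma lambda_le_sqr r k : gamma 0%N = r * L ->
  lambda k <= (2 / (2 + Num.sqrt r * k%:R)) ^+ 2.
Proof.
move=> g0; have r0 : 0 < r by move: gamma0_gt0; rewrite g0 pmulr_lgt0.
have q0 := sqrtr_ge0 r; set q := Num.sqrt r in q0 *.
have H j : (2 + q * j%:R) * Num.sqrt (lambda j) <= 2.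
  elim: j => [|j IH]; first by rewrite /lambda big_ord0 sqrtr1; lra.
  have a0 := alpha_gt0 j; have l0 := lambda_gt0 j.
  set c := Num.sqrt (1 + alpha j); have c2 : c ^+ 2 = 1 + alpha j.
    by rewrite sqr_sqrtr// addr_ge0// ltW.
  have c1 : 1 <= c by rewrite -sqrtr1 ler_sqrt; lra.
  have -> : Num.sqrt (lambda j.+1) = Num.sqrt (lambda j) / c.
    by rewrite lambdaS sqrtrM ?(ltW l0)// sqrtrV// addr_ge0// ltW.
  have m0 := sqrtr_ge0 (lambda j).
  have := sqr_sqrtr (ltW l0); set m := Num.sqrt (lambda j) in IH m0 * => m2.
  (* Squared and multiplied by [L], this is [r * L * lambda j <= gamma j] times [1 + alpha j]. *)
  have qa : q * m * c <= alpha j.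
    rewrite -(@ler_pXn2r _ 2) ?nnegrE ?mulr_ge0 ?(ltW a0) ?sqrtr_ge0//.
    rewrite !exprMn c2 m2 sqr_sqrtr ?(ltW r0)// -(ler_pM2l hL) alpha_sqr.
    have := lambda_le_gamma j; rewrite g0 => lg.
    by rewrite !mulrA ler_pM2r ?addr_gt0// (mulrC L).
  have qm : q * m <= 2 * (c - 1).
    (* [alpha j = (c - 1) * (c + 1)] and [c >= 1]. With [qm], the induction hypothesis then gives
       [(2 + q * j.+1%:R) * m <= 2 + 2 * (c - 1) = 2 * c]. *)
    have ac : alpha j <= 2 * (c - 1) * c.
      by have -> : alpha j = c ^+ 2 - 1; [rewrite c2; lra|nra].
    by rewrite -(@ler_pM2r _ c); lra.
  rewrite mulrA ler_pdivrMr; last by lra.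
  by rewrite -natr1; lra.
have k0 : 0 < 2 + q * k%:R by rewrite ltr_wpDr// mulr_ge0.
rewrite -[lambda k]sqr_sqrtr ?(ltW (lambda_gt0 k))//.
rewrite ler_pXn2r ?nnegrE ?sqrtr_ge0 ?divr_ge0 ?(ltW k0)//.
by rewrite ler_pdivlMr// mulrC.
Qed.

End Rate.

Theorem theorem8p4 (R : realType) (V : completeNormedModType R)
    (dot : {dot V for idfun}) (hdot : inner_product_of_norm dot)
    (mu L : R) (hmu : 0 <= mu) (hmuL : mu <= L) (hL : 0 < L)
    (h : V -> R) (hh : S1 dot mu L h)
    (g : V -> \bar R) (g_proper : proper_fun g)
    (g_lsc : lower_semicontinuous g) (g_convex : econvex g)
    (f : V -> \bar R) (f_def : forall z : V, f z = ((h z)%:E + g z)%E)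
    (xstar : V) (hxstar : xstar \in argmin f)
    (s : R) (s_def : s = 1 / L)
    (x v y : nat -> V) (gamma alpha : nat -> R)
    (gamma0_gt0 : 0 < gamma 0%N)
    (alpha_def : forall k, alpha k =
       (gamma k + Num.sqrt (gamma k ^+ 2 + 4 * L * gamma k)) / (2 * L))
    (y_def : forall k, y k =
       (1 + alpha k)^-1 *: (x k + alpha k *: v k))
    (x_rec : forall k, x k.+1 = prox s g (y k - s *: gradient dot h (y k)))
    (v_rec : forall k, v k.+1 =
       (gamma k + mu * alpha k)^-1 *:
         (gamma k *: v k + (mu * alpha k) *: y k)
       + (gamma k * (1 + alpha k) / (gamma k + mu * alpha k)) *:
         ((alpha k)^-1 *: (x k.+1 - y k)))
    (gamma_rec : forall k, gamma k.+1 =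
       (gamma k + mu * alpha k) / (1 + alpha k))
    (Lyap : nat -> \bar R)
    (Lyap_def : forall k, Lyap k =
       (f (x k) - f xstar + (gamma k / 2 * `|v k - xstar| ^+ 2)%:E)%E) :
  (forall k, (Lyap k.+1 <= Lyap k * ((1 + alpha k)^-1)%:E)%E) /\
  (forall r : R, gamma 0%N = r * L -> mu <= r * L ->
     forall k : nat,
       (Lyap k <= Lyap 0%N *
          (Num.min ((2 / (2 + Num.sqrt r * k%:R)) ^+ 2)
                   ((1 + Num.sqrt (mu / L)) ^- k))%:E)%E).
Proof.
have sE : s = L^-1 by rewrite s_def div1r.
have fE : f = fun z => ((h z)%:E + g z)%E by apply/funext.
have fmin : argmin (fun z => ((h z)%:E + g z)%E) xstar.
  by rewrite -fE; move: hxstar; rewrite inE.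
have a_gt0 := alpha_gt0 hmu hL gamma0_gt0 alpha_def gamma_rec.
have c_gt0 := gamma_gt0 hmu hL gamma0_gt0 alpha_def gamma_rec.
have a_sqr := alpha_sqr hmu hL gamma0_gt0 alpha_def gamma_rec.
have [fs fsE] : exists b, f xstar = b%:E.
  have := argmin_composite_fin g_proper fmin.
  by rewrite f_def; case: (g xstar) => // b _; exists (h xstar + b).
have f_ge z : (fs%:E <= f z)%E by rewrite -fsE fE; exact: fmin.
have step k : (Lyap k.+1 <= Lyap k * ((1 + alpha k)^-1)%:E)%E.
  have [fin_p _] := prox_gradient_inequality hdot hL hh g_proper g_lsc g_convex
    (y k) xstar fmin.
  have ineq z : _ := (prox_gradient_inequality hdot hL hh g_proper g_lsc g_convex
    (y k) z fmin).2.
  move: fin_p ineq; rewrite -sE -x_rec -f_def => + ineq.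
  rewrite !Lyap_def; case fpE : (f (x k.+1)) => [fp||] // _.
  (* If [f (x k) = +oo], the right-hand side is [+oo]. *)
  case fxE : (f (x k)) (f_ge (x k)) => [fx||] // _; last first.
    by rewrite fsE addye// gt0_mulye ?lte_fin ?invr_gt0 ?addr_gt0// leey.
  have := ineq (x k); have := ineq xstar; rewrite -!f_def fpE fxE fsE.
  rewrite -!EFinD -EFinM !lee_fin => iz ix.
  have := accelerated_step_le hdot hmu hL (a_gt0 k) (c_gt0 k) (a_sqr k)
    (y_def k) (v_rec k) ix iz.
  by rewrite -gamma_rec.
split=> // r g0 mur k.
(* The sign allows the product in [Lyap_prod] to be replaced by a larger factor, even when
   [Lyap 0%N = +oo]. *)
have Lyap_ge0 : (0 <= Lyap 0%N)%E.
  rewrite Lyap_def adde_ge0 ?sube_ge0 ?fsE//.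
  by rewrite lee_fin mulr_ge0 ?sqr_ge0// divr_ge0// ltW.
have Lyap_prod : (Lyap k <= Lyap 0%N * (\prod_(i < k) (1 + alpha i)^-1)%:E)%E.
  elim: k => [|k IH]; first by rewrite big_ord0 mule1.
  apply: (le_trans (step k)); rewrite big_ord_recr /= EFinM muleA.
  by rewrite lee_wpmul2r// lee_fin invr_ge0 addr_ge0// ltW.
rewrite -g0 in mur; apply: (le_trans Lyap_prod).
rewrite lee_wpmul2l// lee_fin le_min; apply/andP; split.
  exact: (lambda_le_sqr hmu hL gamma0_gt0 alpha_def gamma_rec).
exact: (lambda_le_exp hmu hL gamma0_gt0 alpha_def gamma_rec).
Qed.
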